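(* For every $0<\delta\leqslant 1$ and every integer $k\geqslant 2$ there exist $\theta>0$ and an integer $q_0\geqslant k$ with the following property. Let $n\geqslant q_0$ be an integer and let $\mathcal{A}\subseteq\{0,1\}^{\binom{[n]}{2}}$ be a $\theta$-quasirandom family of graphs with $\mu(\mathcal{A})\geqslant\delta$. Then there exist $K\subseteq[n]$ with $|K|=k$ and $W\subseteq\binom{[n]}{2}\setminus\binom{K}{2}$ such that \[ \{W\}\cup\Big\{W\cup\{e\}:e\in\binom{K}{2}\Big\}\subseteq\mathcal{A}. \] In particular, there exist $G,H\in\mathcal{A}$ with $H\subseteq G$ such that $G\setminus H=\binom{X}{2}$ for some $X\subseteq[n]$ with $|X|\geqslant 2$.
   Context: A graph on $[n]=\{1,\dots,n\}$ is identified with a subset of $\binom{[n]}{2}$ (the set of 2-element subsets of $[n]$), and subsets of a finite index set $I$ are identified with elements of $\{0,1\}^I$ via indicator functions. $\mu$ is the uniform probability measure on $\{0,1\}^{\binom{[n]}{2}}$. For $\theta>0$, a family $\mathcal{A}\subseteq\{0,1\}^{\binom{[n]}{2}}$ is $\theta$-quasirandom if there exists $\mathcal{U}\subseteq\binom{[n]}{4}$ with $|\mathcal{U}|\geqslant(1-\theta)\binom{n}{4}$ such that for every $U=\{i<j<k<\ell\}\in\mathcal{U}$, \[ \mathbf{P}\big(W:\ W\cup\{\{i,k\}\},\,W\cup\{\{i,\ell\}\},\,W\cup\{\{j,k\}\},\,W\cup\{\{j,\ell\}\}\in\mathcal{A}\big)\leqslant\mu(\mathcal{A})^4+\theta, \]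 where $\mathbf{P}$ is the uniform probability measure on subsets $W$ of $\binom{[n]}{2}\setminus\binom{U}{2}$. *)

(* Defs.v *)
From mathcomp Require Import all_boot all_order all_algebra.
From mathcomp Require Import reals.
Set Implicit Arguments. Unset Strict Implicit. Unset Printing Implicit Defensive.
Import Order.TTheory GRing.Theory Num.Theory.
Local Open Scope ring_scope.

(* Vertex set [n] is 'I_n.  An edge is a 2-element subset of 'I_n; a graph is
   a set of edges; a family of graphs is a set of graphs. *)

Definition edges (n : nat) : {set {set 'I_n}} := [set e : {set 'I_n} | #|e| == 2%N].

Definition pairs (n : nat) (X : {set 'I_n}) : {set {set 'I_n}} :=
  [set e : {set 'I_n} | (e \subset X) && (#|e| == 2%N)].

Definition is_family (n : nat) (A : {set {set {set 'I_n}}}) : Prop :=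
  forall G, G \in A -> G \subset edges n.

Definition mu (R : realType) (n : nat) (A : {set {set {set 'I_n}}}) : R :=
  (#|A|%:R) / (2%:R ^+ #|edges n|).

Definition quad_prob (R : realType) (n : nat) (A : {set {set {set 'I_n}}})
    (i j k l : 'I_n) : R :=
  let D := edges n :\: pairs [set i; j; k; l] in
  (#|[set W in powerset D |
      [&& W :|: [set [set i; k]] \in A, W :|: [set [set i; l]] \in A,
          W :|: [set [set j; k]] \in A & W :|: [set [set j; l]] \in A]]|%:R)
  / (2%:R ^+ #|D|).

Definition quasirandom (R : realType) (n : nat) (theta : R)
    (A : {set {set {set 'I_n}}}) : Prop :=
  exists UU : {set {set 'I_n}},
    (forall U, U \in UU -> #|U| = 4%N) /\
    (1 - theta) * ('C(n, 4))%:R <= (#|UU|)%:R /\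
    (forall i j k l : 'I_n, (i < j)%N -> (j < k)%N -> (k < l)%N ->
       [set i; j; k; l] \in UU ->
       quad_prob R A i j k l <= mu R A ^+ 4 + theta).

(* Main.v *)
Require Import Defs.
From mathcomp Require Import all_boot all_order all_algebra.
From mathcomp Require Import reals ring lra.
Set Implicit Arguments. Unset Strict Implicit. Unset Printing Implicit Defensive.
Import Order.TTheory GRing.Theory Num.Theory.
Local Open Scope ring_scope.

(* Split the vertices into k consecutive blocks and draw L random vertices from
   each; let M be the set of drawn vertices.  Draw a random graph G and delete
   from it all pairs inside M.  When the blocks are large, the resulting graph,
   even after adding one prescribed edge inside M, is close to uniform on
   average (in L2): resamplings on disjoint sets of edges have uncorrelated
   densities, and two independent choices of M are typically disjoint.  Hence
   the arrays X(u, v) = [G + uv in A], indexed by the vertices drawn from two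
   blocks, have mean close to mu(A), and quasirandomness says that their
   four-cycle averages are at most about mu(A)^4.  So X - mu(A) has small box
   norm, and replacing the factors X(u, v) by mu(A) one at a time with the
   Gowers-Cauchy-Schwarz inequality shows that G in A and all X(u_a, u_b) = 1
   hold simultaneously with positive probability, for vertices u_a drawn from
   the a-th block. *)

(** * Uniform averages over finite types, their convexity inequalities, and the box norm *)

Definition avg (R : realFieldType) (T : finType) (f : T -> R) : R :=
  (\sum_t f t) / #|T|%:R.

Local Notation "\avg_ ( i : t ) F" := (avg (fun i : t => F))
  (at level 34, F at level 41, i, t at level 50).
Local Notation "\avg_ i F" := (avg (fun i => F))
  (at level 34, F at level 41, i at level 0, right associativity).

Section Average.
Variable R : realFieldType.

Lemma eq_avg (T : finType) (f g : T -> R) : f =1 g -> avg f = avg g.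
Proof. by move=> fg; rewrite /avg (eq_bigr _ (fun t _ => fg t)). Qed.

Lemma avg_le (T : finType) (f g : T -> R) :
  (forall t, f t <= g t) -> avg f <= avg g.
Proof. by move=> fg; rewrite ler_wpM2r ?invr_ge0 ?ler0n// ler_sum. Qed.

Lemma avgD (T : finType) (f g : T -> R) :
  \avg_ t (f t + g t) = avg f + avg g.
Proof. by rewrite /avg big_split mulrDl. Qed.

Lemma avgZ (T : finType) (c : R) (f : T -> R) : \avg_ t (c * f t) = c * avg f.
Proof. by rewrite /avg -mulr_sumr mulrA. Qed.

Lemma avgZr (T : finType) (c : R) (f : T -> R) : \avg_ t (f t * c) = avg f * c.
Proof. by rewrite mulrC -avgZ; apply: eq_avg => t; rewrite mulrC. Qed.

Lemma avgB (T : finType) (f g : T -> R) :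
  \avg_ t (f t - g t) = avg f - avg g.
Proof. by rewrite /avg sumrB mulrBl. Qed.

Lemma avg_cst (T : finType) (c : R) : (0 < #|T|)%N -> \avg_(t : T) c = c.
Proof.
by move=> T0; rewrite /avg sumr_const -[c *+ _]mulr_natr mulfK// pnatr_eq0 -lt0n.
Qed.

Lemma avg_ge0 (T : finType) (f : T -> R) : (forall t, 0 <= f t) -> 0 <= avg f.
Proof. by move=> f0; rewrite divr_ge0 ?ler0n// sumr_ge0. Qed.

Lemma exchange_avg (S T : finType) (f : S -> T -> R) :
  \avg_ s \avg_ t f s t = \avg_ t \avg_ s f s t.
Proof.
by rewrite /avg -!mulr_suml exchange_big -!mulrA [X in _ * X]mulrC.
Qed.

Lemma avg_pair (S T : finType) (f : S -> T -> R) :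
  \avg_(u : S * T) f u.1 u.2 = \avg_ s \avg_ t f s t.
Proof.
by rewrite /avg -mulr_suml pair_big card_prod natrM invfM mulrA -!mulrA [X in _ * X]mulrC.
Qed.

Lemma avg_sum (T J : finType) (P : pred J) (f : J -> T -> R) :
  \avg_ t \sum_(j | P j) f j t = \sum_(j | P j) \avg_ t f j t.
Proof. by rewrite /avg -mulr_suml exchange_big. Qed.

Lemma avg_eqb (T : finType) (t : T) : \avg_ s (s == t)%:R = (#|T|%:R)^-1 :> R.
Proof. by rewrite /avg (bigD1 t)//= eqxx big1 ?addr0 ?mul1r// => s /negPf ->. Qed.

(** Each diagonal indicator averages to [1 / #|T|]. The term [B] leaves room for a further
    exceptional event. The bound serves twice: for the indices of the draws and for the vertices
    drawn. *)
Lemma avg4_le_diag (T : finType) (F B : T -> T -> T -> T -> R) (c : R) :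
  (0 < #|T|)%N ->
  (forall x y z t, F x y z t <= c + (y == x)%:R + (t == z)%:R + B x y z t) ->
  \avg_ x \avg_ y \avg_ z \avg_ t F x y z t <=
  c + 2 / #|T|%:R + \avg_ x \avg_ y \avg_ z \avg_ t B x y z t.
Proof.
move=> T0 FB.
have -> : c + 2 / #|T|%:R + \avg_ x \avg_ y \avg_ z \avg_ t B x y z t =
   \avg_ x \avg_ y (c + (y == x)%:R + (#|T|%:R)^-1 + \avg_ z \avg_ t B x y z t).
  under [RHS]eq_avg do rewrite !avgD !avg_cst// avg_eqb.
  by rewrite !avgD !avg_cst//; ring.
apply: avg_le => x; apply: avg_le => y.
have -> : c + (y == x)%:R + (#|T|%:R)^-1 + \avg_ z \avg_ t B x y z t =
   \avg_ z \avg_ t (c + (y == x)%:R + (t == z)%:R + B x y z t).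
  under [RHS]eq_avg do rewrite !avgD !avg_cst// avg_eqb.
  by rewrite !avgD !avg_cst.
by apply: avg_le => z; apply: avg_le => t.
Qed.

Lemma avg_bij (S T : finType) (h : S -> T) (f : T -> R) :
  bijective h -> \avg_ s f (h s) = avg f.
Proof.
move=> hb; rewrite /avg (bij_eq_card hb) (reindex h)//.
by apply: onW_bij.
Qed.

Lemma avgM (S T : finType) (f : S -> R) (g : T -> R) :
  avg f * avg g = \avg_ s \avg_ t (f s * g t).
Proof. by rewrite -avgZr; apply: eq_avg => s; rewrite avgZ. Qed.

Lemma le_avg1 (T : finType) (f : T -> R) : (forall t, f t <= 1) -> avg f <= 1.
Proof.
move=> f1; have [T0|T0] := posnP #|T|.
  (* Over an empty type the average is 0, since the inverse of 0 is 0. *)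
  by rewrite /avg T0 invr0 mulr0 ler01.
by rewrite -(avg_cst 1 T0) avg_le.
Qed.

Lemma jensen_sqr (T : finType) (f : T -> R) : (avg f) ^+ 2 <= \avg_ t f t ^+ 2.
Proof.
have [T0|T0] := posnP #|T|.
  by rewrite /avg T0 invr0 !mulr0 expr0n.
have /avg_ge0: forall t, 0 <= (f t - avg f) ^+ 2 by move=> t; exact: sqr_ge0.
rewrite (eq_avg (g := fun t => (f t ^+ 2 - 2 * avg f * f t) + avg f ^+ 2)); last first.
  by move=> t; ring.
by rewrite avgD avgB avgZ avg_cst//; nra.
Qed.

Lemma jensen_pow4 (T : finType) (f : T -> R) : (avg f) ^+ 4 <= \avg_ t f t ^+ 4.
Proof.
have -> : avg f ^+ 4 = (avg f ^+ 2) ^+ 2 by rewrite -exprM.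
apply: (@le_trans _ _ ((\avg_ t f t ^+ 2) ^+ 2)).
  by rewrite ler_sqr ?nnegrE ?sqr_ge0 ?avg_ge0// ?jensen_sqr// => t; exact: sqr_ge0.
apply: le_trans (jensen_sqr _) _.
by rewrite le_eqVlt; apply/orP; left; apply/eqP/eq_avg => t; rewrite -exprM.
Qed.

Lemma avg_mul_sqr_le (T : finType) (f g : T -> R) :
  (forall t, f t ^+ 2 <= 1) -> (\avg_ t (f t * g t)) ^+ 2 <= \avg_ t g t ^+ 2.
Proof.
move=> f1; apply: le_trans (jensen_sqr _) _; apply: avg_le => t.
by rewrite exprMn ler_piMl ?sqr_ge0.
Qed.

(** The fourth power of the Gowers box norm, written as a mean squared codegree; [boxE] gives the
    usual average over four-cycles. *)
Definition box (I J : finType) (g : I -> J -> R) : R :=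
  \avg_ i \avg_ i' (\avg_ j (g i j * g i' j)) ^+ 2.

Lemma boxE (I J : finType) (g : I -> J -> R) :
  box g = \avg_ i \avg_ i' \avg_ j \avg_ j' (g i j * g i' j * (g i j' * g i' j')).
Proof.
by apply: eq_avg => i; apply: eq_avg => i'; rewrite expr2 avgM.
Qed.

(** The four-cycle average treats rows and columns alike, so codegrees may be taken on either
    side. *)
Lemma box_sym (I J : finType) (g : I -> J -> R) : box (fun j i => g i j) = box g.
Proof.
have exch (F : J -> J -> I -> I -> R) :
    \avg_ j \avg_ j' \avg_ i \avg_ i' F j j' i i' =
    \avg_ i \avg_ i' \avg_ j \avg_ j' F j j' i i'.
  have e2 (G : J -> I -> I -> R) :
      \avg_ j \avg_ i \avg_ i' G j i i' = \avg_ i \avg_ i' \avg_ j G j i i'.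
    by rewrite exchange_avg; apply: eq_avg => i; rewrite exchange_avg.
  by rewrite (eq_avg (fun j => e2 _)) e2.
rewrite !boxE exch.
do 4 (apply: eq_avg => ?); ring.
Qed.

End Average.

(** * The Gowers-Cauchy-Schwarz inequality, arrays close to a constant, and the counting lemma *)

Section Counting.
Variable R : realFieldType.

(** Cauchy-Schwarz is applied twice: over [j] to remove the weight [f], then over the pairs [i],
    [i'] to remove the weight [h i * h i']. *)
Lemma gowers_cauchy_schwarz (I J : finType) (g : I -> J -> R) (f : J -> R) (h : I -> R) :
  (forall j, f j ^+ 2 <= 1) -> (forall i, h i ^+ 2 <= 1) ->
  (\avg_ i \avg_ j (g i j * (f j * h i))) ^+ 4 <= box g.
Proof.
move=> f1 h1.
have step1 : (\avg_ i \avg_ j (g i j * (f j * h i))) ^+ 2 <=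
    \avg_ i \avg_ i' (h i * h i' * \avg_ j (g i j * g i' j)).
  rewrite exchange_avg (eq_avg (g := fun j => f j * \avg_ i (g i j * h i))); last first.
    by move=> j; rewrite -avgZ; apply: eq_avg => i; ring.
  apply: le_trans (avg_mul_sqr_le _ f1) _.
  rewrite le_eqVlt; apply/orP; left; apply/eqP.
  transitivity (\avg_ j \avg_ i \avg_ i' (h i * h i' * (g i j * g i' j))).
    apply: eq_avg => j; rewrite expr2 avgM; do 2 (apply: eq_avg => ?); ring.
  rewrite exchange_avg; apply: eq_avg => i; rewrite exchange_avg; apply: eq_avg => i'.
  by rewrite avgZ.
rewrite (exprM _ 2 2).
apply: (@le_trans _ _ ((\avg_ i \avg_ i' (h i * h i' * \avg_ j (g i j * g i' j))) ^+ 2)).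
  by rewrite ler_sqr ?nnegrE ?sqr_ge0//; apply: le_trans step1; exact: sqr_ge0.
apply: le_trans (jensen_sqr _) _; apply: avg_le => i.
apply: avg_mul_sqr_le => i'; rewrite exprMn.
by rewrite -(mulr1 1) ler_pM ?sqr_ge0.
Qed.

Definition upd (C T : finType) (z : {ffun C -> T}) (c : C) (t : T) : {ffun C -> T} :=
  [ffun c' => if c' == c then t else z c'].

(** Exchanging the value at [c] with a fresh value [t] is an involution, so redrawing one coordinate
    preserves the uniform measure. *)
Lemma avg_upd (C T : finType) (c : C) (F : {ffun C -> T} -> R) :
  (0 < #|T|)%N -> avg F = \avg_ z \avg_ t F (upd z c t).
Proof.
move=> T0.
pose sw (u : {ffun C -> T} * T) := (upd u.1 c u.2, u.1 c).
have swK : involutive sw.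
  move=> [z t]; rewrite /sw /=; congr pair; last by rewrite ffunE eqxx.
  by apply/ffunP => c'; rewrite !ffunE; case: eqP => // ->.
rewrite -(avg_pair (fun z t => F (upd z c t))).
rewrite (avg_bij (fun u => F u.1) (Bijective swK swK)).
by rewrite (avg_pair (fun z _ => F z)); apply: eq_avg => z; rewrite avg_cst.
Qed.

(* The mean and the box norm of X force its degrees to be close to m and its
   codegrees to be close to m^2 in L2, which controls the mixed terms. *)
Lemma box_deviation (Omega I J : finType) (X : Omega -> I -> J -> R) (m eta : R) :
  (0 < #|Omega|)%N -> (0 < #|I|)%N -> (0 < #|J|)%N ->
  0 <= m <= 1 -> 0 <= eta ->
  m - eta <= \avg_ o \avg_ i \avg_ j X o i j ->
  \avg_ o box (X o) <= m ^+ 4 + eta ->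
  \avg_ o box (fun i j => X o i j - m) <= 30 * eta.
Proof.
move=> O0 I0 J0 /andP[m0 m1] eta0 meanX boxX.
pose c o i i' := \avg_ j (X o i j * X o i' j).
pose d o i := \avg_ j X o i j.
set mX := \avg_ o \avg_ i \avg_ j X o i j in meanX.
set bX := \avg_ o box (X o) in boxX.
pose c1 := \avg_ o \avg_ i \avg_ i' c o i i'.
pose d2 := \avg_ o \avg_ i d o i ^+ 2.
have bXE : bX = \avg_ o \avg_ i \avg_ i' c o i i' ^+ 2 by [].
(* The mean codegree of two rows is the mean squared degree of a column. *)
have c1_ge : mX ^+ 2 <= c1.
  have -> : c1 = \avg_ o \avg_ j (\avg_ i X o i j) ^+ 2.
    apply: eq_avg => o.
    transitivity (\avg_ j \avg_ i \avg_ i' (X o i j * X o i' j)).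
      rewrite [RHS]exchange_avg; apply: eq_avg => i.
      by rewrite [RHS]exchange_avg.
    by apply: eq_avg => j; rewrite expr2 avgM.
  have -> : mX = \avg_ o \avg_ j \avg_ i X o i j.
    by apply: eq_avg => o; rewrite exchange_avg.
  apply: le_trans (jensen_sqr _) _; apply: avg_le => o; exact: jensen_sqr.
(* Dually, [d2] is the mean codegree of two columns, and by [box_sym] the squares of these codegrees
   also average to [bX]. *)
have d2_le : d2 ^+ 2 <= bX.
  have -> : d2 = \avg_ o \avg_ j \avg_ j' \avg_ i (X o i j * X o i j').
    apply: eq_avg => o.
    transitivity (\avg_ i \avg_ j \avg_ j' (X o i j * X o i j')).
      by apply: eq_avg => i; rewrite expr2 avgM.
    by rewrite exchange_avg; apply: eq_avg => j; rewrite exchange_avg.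
  have -> : bX = \avg_ o box (fun j i => X o i j).
    by apply: eq_avg => o; rewrite box_sym.
  apply: le_trans (jensen_sqr _) _; apply: avg_le => o.
  apply: le_trans (jensen_sqr _) _; apply: avg_le => j.
  exact: jensen_sqr.
(* Centring turns the codegree [c] into [(c - m^2) - m (d i - m) - m (d i' - m)], whose square is at
   most [2 (c - m^2)^2 + 4 m^2 (d i - m)^2 + 4 m^2 (d i' - m)^2]; the right-hand side is the average
   of this bound. *)
have main : \avg_ o box (fun i j => X o i j - m) <=
    2 * (bX - 2 * m ^+ 2 * c1 + m ^+ 4) + 8 * m ^+ 2 * (d2 - 2 * m * mX + m ^+ 2).
  apply: (@le_trans _ _ (\avg_ o \avg_ i \avg_ i'
     ((2 * c o i i' ^+ 2 - 4 * m ^+ 2 * c o i i' + 2 * m ^+ 4)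
      + ((4 * m ^+ 2 * d o i ^+ 2 - 8 * m ^+ 3 * d o i + 4 * m ^+ 4)
      + (4 * m ^+ 2 * d o i' ^+ 2 - 8 * m ^+ 3 * d o i' + 4 * m ^+ 4))))).
    apply: avg_le => o; apply: avg_le => i; apply: avg_le => i'.
    have -> : \avg_ j ((X o i j - m) * (X o i' j - m)) =
        c o i i' - m * d o i - m * d o i' + m ^+ 2.
      rewrite (eq_avg (g := fun j =>
        X o i j * X o i' j - m * X o i j - m * X o i' j + m ^+ 2)).
        by rewrite avgD !avgB !avgZ avg_cst.
      by move=> j; ring.
    move: (c o i i') (d o i) (d o i') => x y z.
    rewrite -subr_ge0.
    have -> : 2 * x ^+ 2 - 4 * m ^+ 2 * x + 2 * m ^+ 4 +
      (4 * m ^+ 2 * y ^+ 2 - 8 * m ^+ 3 * y + 4 * m ^+ 4 +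
       (4 * m ^+ 2 * z ^+ 2 - 8 * m ^+ 3 * z + 4 * m ^+ 4)) -
       (x - m * y - m * z + m ^+ 2) ^+ 2 =
       ((x - m ^+ 2) + m * (y - m) + m * (z - m)) ^+ 2 +
       2 * (m * (y - m) - m * (z - m)) ^+ 2 by ring.
    by rewrite addr_ge0 ?sqr_ge0// mulr_ge0 ?sqr_ge0.
  rewrite le_eqVlt; apply/orP; left; apply/eqP.
  have avg3 (q : Omega -> I -> I -> R) (r : Omega -> I -> R) :
      \avg_ o \avg_ i \avg_ i' (q o i i' + (r o i + r o i')) =
      \avg_ o \avg_ i \avg_ i' q o i i' + 2 * \avg_ o \avg_ i r o i.
    rewrite -avgZ -avgD; apply: eq_avg => o.
    under eq_avg do rewrite !avgD avg_cst//.
    by rewrite !avgD avg_cst//; ring.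
  have quad (T : finType) (f g : T -> R) x y z : (0 < #|T|)%N ->
      \avg_ t (x * f t - y * g t + z) = x * avg f - y * avg g + z.
    by move=> T0; rewrite avgD avgB !avgZ avg_cst.
  rewrite avg3.
  transitivity ((2 * bX - 4 * m ^+ 2 * c1 + 2 * m ^+ 4) +
    2 * (4 * m ^+ 2 * d2 - 8 * m ^+ 3 * mX + 4 * m ^+ 4)); last by ring.
  congr (_ + 2 * _).
    rewrite bXE -quad//; apply: eq_avg => o.
    by rewrite -quad//; apply: eq_avg => i; rewrite -quad.
  by rewrite -quad//; apply: eq_avg => o; rewrite -quad.
have mX2 : m ^+ 2 - 2 * m * eta <= mX ^+ 2.
  have h0 : 0 <= (mX - m) ^+ 2 by exact: sqr_ge0.
  have : 0 <= m * (mX - (m - eta)) by rewrite mulr_ge0 ?subr_ge0.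
  nra.
have hA : 2 * (bX - 2 * m ^+ 2 * c1 + m ^+ 4) <= 10 * eta.
  have : m ^+ 2 * (m ^+ 2 - 2 * m * eta) <= m ^+ 2 * c1.
    by rewrite ler_wpM2l ?sqr_ge0//; exact: le_trans mX2 c1_ge.
  have : m ^+ 3 * eta <= eta by rewrite ler_piMl ?exprn_ile1.
  nra.
(* Expanding [(d2 - m^2)^2 >= 0] gives [2 m^2 d2 <= d2^2 + m^4 <= 2 m^4 + eta], which avoids a
   square root of the bound on [d2^2]. *)
have hB : 8 * m ^+ 2 * (d2 - 2 * m * mX + m ^+ 2) <= 20 * eta.
  have h0 : 0 <= (d2 - m ^+ 2) ^+ 2 by exact: sqr_ge0.
  have : m ^+ 3 * (m - eta) <= m ^+ 3 * mX by rewrite ler_wpM2l ?exprn_ge0.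
  have : m ^+ 3 * eta <= eta by rewrite ler_piMl ?exprn_ile1.
  nra.
lra.
Qed.

Lemma prodr_unit (I : Type) (s : seq I) (P : pred I) (F : I -> R) :
  (forall i, 0 <= F i <= 1) -> 0 <= \prod_(i <- s | P i) F i <= 1.
Proof.
move=> F01; elim/big_ind: _ => [|x y /andP[x0 x1] /andP[y0 y1]|i _]; last exact: F01.
  by rewrite ler01 lexx.
by rewrite mulr_ge0//= mulr_ile1.
Qed.

(** Induction on [es]: replacing one factor [X] by [m] costs at most [eta], because the box norm of
    [X - m] bounds its correlation with the product of all remaining factors. [X0] does not involve
    [z] and is carried along as a bounded weight. *)
Lemma counting (Omega : finType) (k L : nat) (m eta : R)
    (X0 : Omega -> R) (X : 'I_k -> 'I_k -> Omega -> 'I_L -> 'I_L -> R)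
    (es : seq ('I_k * 'I_k)) :
  (0 < #|Omega|)%N -> (0 < L)%N -> 0 <= m <= 1 -> 0 <= eta ->
  (forall o, 0 <= X0 o <= 1) -> (forall a b o l p, 0 <= X a b o l p <= 1) ->
  (forall a b : 'I_k, (a < b)%N ->
     \avg_ o box (fun l p => X a b o l p - m) <= eta ^+ 4) ->
  uniq es -> all (fun q : 'I_k * 'I_k => (q.1 < q.2)%N) es ->
  m ^+ size es * avg X0 - (size es)%:R * eta <=
  \avg_ o \avg_(z : {ffun 'I_k -> 'I_L})
     (X0 o * \prod_(q <- es) X q.1 q.2 o (z q.1) (z q.2)).
Proof.
move=> O0 L0 /andP[m0 m1] eta0 X01 X1 hbox.
have IL0 : (0 < #|'I_L|)%N by rewrite card_ord.
have Z0 : (0 < #|{ffun 'I_k -> 'I_L}|)%N by rewrite card_ffun expn_gt0 IL0.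
elim: es => [|[a b] es IH] /=.
  rewrite mul1r mul0r subr0 => _ _; apply: avg_le => o.
  by under eq_avg do rewrite big_nil mulr1; rewrite avg_cst.
case/andP=> abes ues /andP[ab ltes].
have {IH} := IH ues ltes.
pose P o (z : {ffun 'I_k -> 'I_L}) :=
  X0 o * \prod_(q <- es) X q.1 q.2 o (z q.1) (z q.2).
rewrite -/(\avg_ o avg (P o)) => IH.
have -> : \avg_ o \avg_(z : {ffun 'I_k -> 'I_L})
     (X0 o * \prod_(q <- (a, b) :: es) X q.1 q.2 o (z q.1) (z q.2)) =
   m * (\avg_ o avg (P o)) +
   \avg_ o \avg_(z : {ffun 'I_k -> 'I_L}) ((X a b o (z a) (z b) - m) * P o z).
  rewrite -avgZ -avgD; apply: eq_avg => o; rewrite -avgZ -avgD; apply: eq_avg => z.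
  by rewrite big_cons /P /=; ring.
set err := \avg_ o \avg_ z (_ * P o z).
suff errE : - eta <= err.
  have : m * (m ^+ size es * avg X0 - (size es)%:R * eta) <= m * \avg_ o avg (P o).
    by rewrite ler_wpM2l.
  have : m * ((size es)%:R * eta) <= (size es)%:R * eta.
    by rewrite ler_piMl ?mulr_ge0.
  by rewrite -natr1 exprS; nra.
suff err4 : err ^+ 4 <= eta ^+ 4.
  rewrite lerNl; apply: le_trans (_ : `|err| <= _); first by rewrite -normrN ler_norm.
  rewrite -(@ler_pXn2r _ 4) ?nnegrE ?normr_ge0// -normrX ger0_norm//.
  by rewrite (exprM _ 2 2) sqr_ge0.
apply: le_trans (hbox a b ab).
apply: le_trans (jensen_pow4 _) _; apply: avg_le => o.
(* The values of [z] at [a] and [b] become free variables [l] and [p]; the other coordinates of [z]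
   will be fixed. *)
rewrite (avg_upd b)// (avg_upd a)//.
apply: le_trans (jensen_pow4 _) _; rewrite -(avg_cst (box _) Z0); apply: avg_le => z.
have nab : a != b by rewrite -val_eqE neq_ltn ab.
(* Factors through [a] depend on [l] alone: their pairs are increasing and differ from [(a, b)], so
   they avoid [b]. The other factors depend on [p] alone. *)
pose has_a (q : 'I_k * 'I_k) := (q.1 == a) || (q.2 == a).
pose f p := X0 o * \prod_(q <- es | ~~ has_a q)
  X q.1 q.2 o (upd z b p q.1) (upd z b p q.2).
pose h l := \prod_(q <- es | has_a q)
  X q.1 q.2 o (upd z a l q.1) (upd z a l q.2).
have sqr1 (x : R) : 0 <= x <= 1 -> x ^+ 2 <= 1.
  by case/andP=> x0 x1; rewrite exprn_ile1.
have f1 p : f p ^+ 2 <= 1.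
  rewrite sqr1 // /f; have /andP[X00 X01'] := X01 o.
  have /andP[p0 p1] := prodr_unit es (fun q => ~~ has_a q)
    (fun q => X1 q.1 q.2 o (upd z b p q.1) (upd z b p q.2)).
  by rewrite mulr_ge0 //= mulr_ile1.
have h1 l : h l ^+ 2 <= 1.
  by apply: sqr1; apply: prodr_unit => q; exact: X1.
apply: le_trans (gowers_cauchy_schwarz (fun l p => X a b o l p - m) f1 h1).
rewrite le_eqVlt; apply/orP; left; apply/eqP; congr (_ ^+ 4).
apply: eq_avg => l; apply: eq_avg => p.
rewrite !ffunE !eqxx (negPf nab); congr (_ * _).
rewrite /P /f /h -mulrA; congr (_ * _).
rewrite mulrC (bigID has_a) /=; congr (_ * _).
  rewrite big_seq_cond [RHS]big_seq_cond; apply: eq_bigr => -[c d] /andP[cd_es].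
  have cd := allP ltes _ cd_es.
  rewrite /has_a /= in cd *; move=> ha; rewrite !ffunE.
  have -> : (c == b) = false.
    apply/negP => /eqP cb; move: ha cd; rewrite cb eq_sym (negPf nab) /= => /eqP ->.
    by rewrite ltnNge ltnW.
  have -> // : (d == b) = false.
  apply/negP => /eqP db; move: ha; rewrite db [b == a]eq_sym (negPf nab) orbF => /eqP ca.
  by move: abes; rewrite -db -ca cd_es.
apply: eq_bigr => -[c d] /=; rewrite negb_or /= => /andP[/negPf ca /negPf da].
by rewrite !ffunE ca da.
Qed.

End Counting.

(** * Overwriting a uniform random set on prescribed coordinates *)

Section Resampling.
Variables (R : realFieldType) (T : finType).
Implicit Types (S P x y : {set T}) (f : {set T} -> R).

(** For [P \subset S], this is the density, relative to the uniform measure, of the law of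
    [(x :\: S) :|: P] with [x] uniform. *)
Definition density S P x : R := 2 ^+ #|S| * (x :&: S == P)%:R.

Lemma notin_subset S P t : P \subset S -> t \in S = false -> t \in P = false.
Proof. by move=> /subsetP PS; apply: contraFF; exact: PS. Qed.

Lemma sum_resample S P f : P \subset S ->
  \sum_x f ((x :\: S) :|: P) = \sum_x (f x * density S P x).
Proof.
move=> PS.
rewrite (partition_big (fun x => (x :\: S) :|: P) (fun y => y :&: S == P)) /=; last first.
  move=> x _; apply/eqP/setP => t; rewrite !inE.
  case tS: (t \in S); rewrite ?andbT ?andbF//=.
  by rewrite (notin_subset PS tS).
rewrite [RHS](bigID (fun y => y :&: S == P)) /= [X in _ = _ + X]big1 ?addr0; last first.
  by move=> y /negPf yS; rewrite /density yS !mulr0.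
apply: eq_bigr => y yS.
rewrite (eq_bigr (fun=> f y)); last by move=> x /eqP ->.
rewrite sumr_const /density yS mulr1 -[LHS]mulr_natr -natrX; congr (_ * _%:R).
(* The fibre over [y] has exactly one element for each possible trace [Q] on [S]. *)
have <- : #|[set (y :\: S) :|: Q | Q in powerset S]| = (2 ^ #|S|)%N.
  rewrite card_in_imset ?card_powerset// => Q Q'; rewrite !powersetE => QS Q'S /setP QQ'.
  apply/setP => t; have := QQ' t; rewrite !inE.
  case tS: (t \in S) => //= _.
  by rewrite (notin_subset QS tS) (notin_subset Q'S tS).
apply: eq_card => x; apply/(@eqP {set T})/imsetP => [xy|[Q]].
  exists (x :&: S); first by rewrite powersetE subsetIr.
  rewrite -xy; apply/setP => t; rewrite !inE.
  case tS: (t \in S); rewrite ?andbT ?andbF ?orbF//=.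
  by rewrite (notin_subset PS tS) orbF.
rewrite powersetE => QS ->; apply/setP => t; move/eqP/setP/(_ t): yS; rewrite !inE.
case tS: (t \in S); rewrite ?andbT ?andbF/=; first by move=> ->.
by move=> <-; rewrite (notin_subset QS tS) !orbF.
Qed.

Lemma avg_resample S P f : P \subset S ->
  \avg_ x f ((x :\: S) :|: P) = \avg_ x (f x * density S P x).
Proof. by move=> PS; rewrite /avg sum_resample. Qed.

Lemma set_card_gt0 : (0 < #|{set T}|)%N.
Proof. by apply/card_gt0P; exists set0. Qed.

Lemma avg_density S P : P \subset S -> avg (density S P) = 1.
Proof.
move=> PS; have := avg_resample (fun=> 1) PS.
by rewrite avg_cst ?set_card_gt0// => /esym <-; apply: eq_avg => x; rewrite mul1r.
Qed.

Lemma density_mul S P S' P' x : P \subset S -> P' \subset S' -> S :&: S' = set0 ->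
  density S P x * density S' P' x = density (S :|: S') (P :|: P') x.
Proof.
move=> PS PS' SS'; rewrite /density mulrACA -exprD cardsU SS' cards0 subn0.
congr (_ * _); rewrite -natrM mulnb; congr (_%:R); congr nat_of_bool.
have SS'f t : t \in S -> t \in S' = false.
  by move=> tS; apply/negP => tS'; have := in_set0 t; rewrite -SS' inE tS tS'.
apply/andP/eqP => [[/eqP <- /eqP <-]|/setP xE]; first by rewrite setIUr.
split; apply/eqP/setP => t; have := xE t; rewrite !inE.
  case tS: (t \in S) => /=; last first.
    by rewrite andbF (notin_subset PS tS).
  by rewrite (notin_subset PS' (SS'f _ tS)) orbF.
case tS': (t \in S'); last first.
  by rewrite andbF (notin_subset PS' tS').
have tS : t \in S = false by apply: contraTF tS' => /SS'f ->.
by rewrite orbT (notin_subset PS tS).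
Qed.

(** For disjoint [S] and [S'] the product is again a density and has mean 1. Otherwise the second
    factor is at most [2 ^+ s] and the first has mean 1. *)
Lemma avg_density_mul S P S' P' (s : nat) : P \subset S -> P' \subset S' ->
  (#|S'| <= s)%N ->
  \avg_ x (density S P x * density S' P' x) <= 1 + 2 ^+ s * (S :&: S' != set0)%:R.
Proof.
move=> PS PS' Ss; case: eqP => [SS'|_] /=; rewrite ?mulr0 ?addr0 ?mulr1.
  by under eq_avg do rewrite density_mul//; rewrite avg_density// setUSS.
apply: (@le_trans _ _ (2 ^+ s * avg (density S P))).
  2: by rewrite avg_density// mulr1 lerDr ler01.
rewrite -avgZ; apply: avg_le => x.
rewrite mulrC ler_wpM2r//; first by rewrite mulr_ge0 ?exprn_ge0 ?ler0n.
rewrite /density; apply: (@le_trans _ _ (2 ^+ #|S'|)).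
  by rewrite ler_piMr ?exprn_ge0// lern1 leq_b1.
by apply: ler_weXn2l; rewrite ?ler1n.
Qed.

(* The laws of the resampled sets average to a density close to 1 in L2, because
   the densities of disjointly supported resamplings are uncorrelated. *)
Lemma resample_close (I : finType) (S P : I -> {set T}) (s : nat) f :
  (0 < #|I|)%N -> (forall r, P r \subset S r) -> (forall r, (#|S r| <= s)%N) ->
  (forall x, 0 <= f x <= 1) ->
  (\avg_ r \avg_ x f ((x :\: S r) :|: P r) - avg f) ^+ 2 <=
  2 ^+ s * \avg_ r \avg_ r' (S r :&: S r' != set0)%:R.
Proof.
move=> I0 PS Ss f01.
(* The error is the correlation of [f] with [D]. As [f] is bounded by 1, it remains to bound the
   mean of [D^2], which expands into covariances of pairs of densities. *)
pose D x := \avg_ r density (S r) (P r) x - 1.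
have -> : \avg_ r \avg_ x f ((x :\: S r) :|: P r) - avg f = \avg_ x (f x * D x).
  rewrite -[avg f]mul1r -avgZ /D.
  under eq_avg do rewrite avg_resample//.
  rewrite exchange_avg -avgB; apply: eq_avg => x.
  by rewrite avgZ; ring.
have f1 x : f x ^+ 2 <= 1 by case/andP: (f01 x) => f0 f1; rewrite exprn_ile1.
apply: le_trans (avg_mul_sqr_le _ f1) _.
have -> : \avg_ x D x ^+ 2 =
    \avg_ r \avg_ r' (\avg_ x (density (S r) (P r) x * density (S r') (P r') x) - 1).
  transitivity (\avg_ x (\avg_ r \avg_ r' (density (S r) (P r) x * density (S r') (P r') x)
       - 2 * \avg_ r density (S r) (P r) x + 1)).
    by apply: eq_avg => x; rewrite -avgM /D; ring.
  rewrite avgD avgB avgZ avg_cst ?set_card_gt0// exchange_avg.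
  under eq_avg do rewrite exchange_avg.
  rewrite [X in _ - 2 * X + _]exchange_avg.
  rewrite (eq_avg (fun r => avg_density (PS r))) avg_cst//.
  under [RHS]eq_avg do rewrite avgB avg_cst//.
  by rewrite avgB avg_cst//; ring.
rewrite -avgZ; apply: avg_le => r; rewrite -avgZ; apply: avg_le => r'.
by rewrite lerBlDl; exact: avg_density_mul.
Qed.

(** Intersecting with [D] overwrites the complement of [D] by the empty set, so a uniform [x]
    induces a uniform subset of [D]. *)
Lemma avg_setI (D : {set T}) f :
  \avg_ x f (x :&: D) = (\sum_(W in powerset D) f W) / 2 ^+ #|D|.
Proof.
have := sum_resample f (sub0set (~: D)).
under eq_bigr do rewrite setU0 setDE setCK.
rewrite /avg => ->.
rewrite (bigID (fun x => x \in powerset D)) /= [X in _ + X]big1 ?addr0; last first.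
  move=> x; rewrite powersetE /density -setDE setD_eq0 => /negPf ->.
  by rewrite !mulr0.
rewrite (eq_bigr (fun x => f x * 2 ^+ #|~: D|)); last first.
  by move=> x; rewrite powersetE /density -setDE setD_eq0 => ->; rewrite mulr1.
have -> : #|{set T}| = (2 ^ (#|D| + #|~: D|))%N.
  by rewrite cardsC -cardsT -card_powerset powersetT cardsT.
rewrite -mulr_suml natrX exprD -mulrA; congr (_ * _).
by rewrite invfM mulrCA mulfV ?mulr1// expf_neq0// pnatr_eq0.
Qed.

End Resampling.

(** * Random vertices drawn from [k] ordered blocks *)

Definition increasing_pairs k : seq ('I_k * 'I_k) :=
  [seq q : 'I_k * 'I_k <- enum [set: 'I_k * 'I_k] | (q.1 < q.2)%N].

Section RandomBlocks.
Variables (R : realType) (n k L N : nat) (A : {set {set {set 'I_n}}}).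
Variable vtx : 'I_k -> 'I_N -> 'I_n.
Hypothesis vtx_inj : forall a a' y y', vtx a y = vtx a' y' -> a = a' /\ y = y'.
Hypothesis vtx_lt : forall (a b : 'I_k) y y', (a < b)%N -> (vtx a y < vtx b y')%N.
Hypotheses (L0 : (0 < L)%N) (N0 : (0 < N)%N).
Hypothesis familyA : is_family A.

Let coord := ('I_k * 'I_L)%type.
Let choice_fun := {ffun coord -> 'I_N}.

Let I0 : (0 < #|'I_N|)%N. Proof. by rewrite card_ord. Qed.
Let J0 : (0 < #|'I_L|)%N. Proof. by rewrite card_ord. Qed.
Let W0 : (0 < #|choice_fun|)%N. Proof. by rewrite card_ffun expn_gt0 I0. Qed.
Let G0 : (0 < #|{set {set 'I_n}}|)%N. Proof. exact: set_card_gt0. Qed.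

(** The coordinate [(a, l)] is the [l]-th draw from block [a]. Draws are made with replacement, so
    vertices of one block may coincide. *)
Definition pick_vtx (w : {ffun 'I_k * 'I_L -> 'I_N}) (c : 'I_k * 'I_L) : 'I_n :=
  vtx c.1 (w c).
Definition picked (w : {ffun 'I_k * 'I_L -> 'I_N}) : {set 'I_n} :=
  [set pick_vtx w c | c : 'I_k * 'I_L].
(** The randomness [x] is a uniform set of arbitrary vertex sets; its 2-element members form a
    uniform graph. *)
Definition base (w : {ffun 'I_k * 'I_L -> 'I_N}) (x : {set {set 'I_n}}) :=
  (x :&: edges n) :\: pairs (picked w).

Lemma pick_vtx_picked w c : pick_vtx w c \in picked w.
Proof. by apply/imsetP; exists c. Qed.

Lemma card_pairs_picked w : (#|pairs (picked w)| <= 2 ^ (k * L))%N.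
Proof.
apply: (@leq_trans #|powerset (picked w)|).
  by apply/subset_leq_card/subsetP => e; rewrite !inE => /andP[].
rewrite card_powerset leq_exp2l//.
by apply: leq_trans (leq_imset_card _ _) _; rewrite card_prod !card_ord.
Qed.

Lemma avg_coord_eq (c : coord) (y : 'I_N) :
  \avg_(r : choice_fun) (r c == y)%:R = (N%:R)^-1 :> R.
Proof.
rewrite (avg_upd c)//.
under eq_avg do under eq_avg do rewrite ffunE eqxx.
under eq_avg do rewrite avg_eqb card_ord.
by rewrite avg_cst.
Qed.

(** Union bound over the pairs of coordinates: [r c] and [r' c'] are independent and agree with
    probability [1 / N]. *)
Lemma avg_coincidence (B : choice_fun -> choice_fun -> bool) :
  (forall r r', B r r' -> exists c, exists c', r c = r' c') ->
  \avg_ r \avg_ r' (B r r')%:R <= ((k * L) ^ 2)%:R / N%:R :> R.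
Proof.
move=> hB.
apply: (@le_trans _ _ (\sum_(c : coord) \sum_(c' : coord)
   \avg_(r : choice_fun) \avg_(r' : choice_fun) (r c == r' c')%:R)).
  under eq_bigr do rewrite -avg_sum.
  rewrite -avg_sum; apply: avg_le => r.
  under eq_bigr do rewrite -avg_sum.
  rewrite -avg_sum; apply: avg_le => r'.
  case Brr: (B r r') => /=; last by do 2 (apply: sumr_ge0 => ? _).
  have [c [c' cc']] := hB _ _ Brr.
  rewrite (bigD1 c)//= (bigD1 c')//= cc' eqxx -addrA lerDl.
  by rewrite addr_ge0// ?sumr_ge0// => ? _; rewrite sumr_ge0.
rewrite le_eqVlt; apply/orP; left; apply/eqP.
transitivity (\sum_(c : coord) \sum_(c' : coord) (N%:R)^-1 : R).
  apply: eq_bigr => c _; apply: eq_bigr => c' _.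
  rewrite exchange_avg -[RHS](avg_cst _ W0); apply: eq_avg => r'.
  exact: avg_coord_eq.
by rewrite !sumr_const card_prod !card_ord -mulrnA mulnn mulr_natl.
Qed.

Variable eps : R.
Hypothesis eps0 : 0 <= eps.
Hypothesis epsP :
  2 ^+ (2 ^ (k * L)) * (((k * L) ^ 2)%:R / N%:R) <= eps ^+ 2.

(** This is [resample_close] with support size at most [2 ^ (k * L)]: two supports meet only if some
    values of the independent draws agree, and [epsP] then bounds the squared error by
    [eps ^+ 2]. *)
Lemma resample_picked (S P : choice_fun -> {set {set 'I_n}}) (f : {set {set 'I_n}} -> R) :
  (forall r, P r \subset S r) -> (forall r, (#|S r| <= 2 ^ (k * L))%N) ->
  (forall r r', S r :&: S r' != set0 -> exists c, exists c', r c = r' c') ->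
  (forall x, 0 <= f x <= 1) ->
  avg f - eps <= \avg_ r \avg_ x f ((x :\: S r) :|: P r) <= avg f + eps.
Proof.
move=> PS Sc Scoin f01.
have := resample_close W0 PS Sc f01.
set D := _ - _ => D2.
have : D ^+ 2 <= eps ^+ 2.
  apply: le_trans D2 _; apply: le_trans epsP.
  by rewrite ler_wpM2l ?exprn_ge0//; exact: avg_coincidence.
rewrite -ler_sqrt ?sqr_ge0// !sqrtr_sqr (ger0_norm eps0) ler_norml /D.
by move=> /andP[]; lra.
Qed.

Lemma mu_avg : mu R A = \avg_ x (x :&: edges n \in A)%:R.
Proof.
rewrite (avg_setI _ (fun W => (W \in A)%:R)) /mu; congr (_ / _).
rewrite -sum1_card natr_sum big_mkcond [RHS]big_mkcond /=.
apply: eq_bigr => W _; rewrite powersetE.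
by case: ifPn => [/familyA ->//|_]; case: ifP.
Qed.

Lemma pairs_picked_coincidence w w' :
  pairs (picked w) :&: pairs (picked w') != set0 -> exists c, exists c', w c = w' c'.
Proof.
case/set0Pn => e; rewrite !inE => /andP[/andP[/subsetP ew e2] /andP[/subsetP ew' _]].
have /card_gt0P[t te] : (0 < #|e|)%N by rewrite (eqP e2).
have /imsetP[c _ tc] := ew _ te; have /imsetP[c' _ tc'] := ew' _ te.
by exists c, c'; have [] := vtx_inj (etrans (esym tc) tc').
Qed.

Lemma baseE w x : base w x = (x :\: pairs (picked w)) :&: edges n.
Proof. by rewrite /base setIDAC. Qed.

(** Deleting all pairs of drawn vertices and inserting [P w] is a single resampling. The cases of
    interest are [P w] empty and [P w] one edge. *)
Lemma avg_base (P : choice_fun -> {set {set 'I_n}}) :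
  (forall w, P w \subset pairs (picked w)) ->
  mu R A - eps <= \avg_ w \avg_ x (base w x :|: P w \in A)%:R <= mu R A + eps.
Proof.
move=> PS; rewrite mu_avg.
have -> : \avg_ w \avg_ x (base w x :|: P w \in A)%:R =
    \avg_ w \avg_ x (((x :\: pairs (picked w)) :|: P w) :&: edges n \in A)%:R :> R.
  apply: eq_avg => w; apply: eq_avg => x; rewrite setIUl -baseE.
  suff -> : P w :&: edges n = P w by [].
  apply/setIidPl; apply: subset_trans (PS w) _.
  by apply/subsetP => e; rewrite !inE => /andP[].
apply: (resample_picked (f := fun x => (x :&: edges n \in A)%:R)) => //.
- exact: card_pairs_picked.
- exact: pairs_picked_coincidence.
- by move=> x; rewrite ler0n lern1 leq_b1.
Qed.

Lemma quad_prob_avg i j p q :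
  quad_prob R A i j p q = \avg_ x
    [&& (x :&: (edges n :\: pairs [set i; j; p; q])) :|: [set [set i; p]] \in A,
        (x :&: (edges n :\: pairs [set i; j; p; q])) :|: [set [set i; q]] \in A,
        (x :&: (edges n :\: pairs [set i; j; p; q])) :|: [set [set j; p]] \in A &
        (x :&: (edges n :\: pairs [set i; j; p; q])) :|: [set [set j; q]] \in A]%:R.
Proof.
rewrite (avg_setI _ (fun W : {set {set 'I_n}} =>
   [&& W :|: [set [set i; p]] \in A, W :|: [set [set i; q]] \in A,
       W :|: [set [set j; p]] \in A & W :|: [set [set j; q]] \in A]%:R)).
rewrite /quad_prob; congr (_ / _).
rewrite -sum1_card natr_sum big_mkcond [RHS]big_mkcond /=.
by apply: eq_bigr => W _; rewrite inE; case: (W \in powerset _) => //=; case: [&& _, _, _ & _].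
Qed.

Lemma quad_prob_swapl i j p q : quad_prob R A j i p q = quad_prob R A i j p q.
Proof.
rewrite !quad_prob_avg (setUC [set j] [set i]); apply: eq_avg => x.
congr (_%:R); congr nat_of_bool.
by do 4 case: (_ \in A).
Qed.

Lemma quad_prob_swapr i j p q : quad_prob R A i j q p = quad_prob R A i j p q.
Proof.
rewrite !quad_prob_avg -!(setUA [set i; j]) (setUC [set q] [set p]).
apply: eq_avg => x.
congr (_%:R); congr nat_of_bool.
by do 4 case: (_ \in A).
Qed.

(** * Four-cycle averages of the edge arrays under quasirandomness *)

Variables (theta : R) (UU : {set {set 'I_n}}).
Hypothesis quadP : forall i j p q : 'I_n, (i < j)%N -> (j < p)%N -> (p < q)%N ->
  [set i; j; p; q] \in UU -> quad_prob R A i j p q <= mu R A ^+ 4 + theta.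

(** Quasirandomness concerns increasing vertices. The blocks are ordered, and swapping the two
    vertices of one block leaves [quad_prob] unchanged, so the order inside a block is
    immaterial. *)
Lemma quad_prob_le (a b : 'I_k) y1 y2 y3 y4 : (a < b)%N -> y1 != y2 -> y3 != y4 ->
  [set vtx a y1; vtx a y2; vtx b y3; vtx b y4] \in UU ->
  quad_prob R A (vtx a y1) (vtx a y2) (vtx b y3) (vtx b y4) <= mu R A ^+ 4 + theta.
Proof.
move=> ab y12 y34.
have vneq c y y' : y != y' -> (vtx c y < vtx c y')%N || (vtx c y' < vtx c y)%N.
  move=> yy'; rewrite -neq_ltn; apply: contra yy' => /eqP/val_inj vv.
  by have [_ ->] := vtx_inj vv.
have sorted3 y y' z z' : (vtx b z < vtx b z')%N -> (vtx a y < vtx a y')%N ->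
    [set vtx a y; vtx a y'; vtx b z; vtx b z'] \in UU ->
    quad_prob R A (vtx a y) (vtx a y') (vtx b z) (vtx b z') <= mu R A ^+ 4 + theta.
  by move=> zz' yy'; apply: quadP => //; exact: vtx_lt.
have sorted2 y y' z z' : y != y' -> (vtx b z < vtx b z')%N ->
    [set vtx a y; vtx a y'; vtx b z; vtx b z'] \in UU ->
    quad_prob R A (vtx a y) (vtx a y') (vtx b z) (vtx b z') <= mu R A ^+ 4 + theta.
  move=> /(vneq a)/orP[yy'|yy'] zz'; first exact: sorted3.
  by rewrite (setUC [set vtx a y]) -quad_prob_swapl; exact: sorted3.
have /orP[yy'|yy'] := vneq b _ _ y34; first exact: sorted2.
rewrite -quad_prob_swapr -(setUA [set vtx a y1; vtx a y2]) (setUC [set vtx b y3]) setUA.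
exact: sorted2.
Qed.

Definition edge_ind (a b : 'I_k) (o : {ffun 'I_k * 'I_L -> 'I_N} * {set {set 'I_n}})
    (l p : 'I_L) : R :=
  (base o.1 o.2 :|: [set [set pick_vtx o.1 (a, l); pick_vtx o.1 (b, p)]] \in A)%:R.

Lemma edge_ind01 a b o l p : 0 <= edge_ind a b o l p <= 1.
Proof. by rewrite ler0n lern1 leq_b1. Qed.

Definition edge_box a b o (l l' p p' : 'I_L) : R :=
  edge_ind a b o l p * edge_ind a b o l' p * (edge_ind a b o l p' * edge_ind a b o l' p').

Lemma edge_box_le1 a b o l l' p p' : edge_box a b o l l' p p' <= 1.
Proof. by rewrite /edge_box /edge_ind -!natrM lern1 !mulnb leq_b1. Qed.

Definition upd4 (a b : 'I_k) (l l' p p' : 'I_L) y1 y2 y3 y4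
    (r : {ffun 'I_k * 'I_L -> 'I_N}) :=
  upd (upd (upd (upd r (a, l) y1) (a, l') y2) (b, p) y3) (b, p') y4.

Lemma avg_upd4 a b l l' p p' (F : choice_fun -> R) :
  avg F = \avg_ y4 \avg_ y3 \avg_ y2 \avg_ y1 \avg_ r F (upd4 a b l l' p p' y1 y2 y3 y4 r).
Proof.
have upd1 c (G : choice_fun -> R) : avg G = \avg_ y \avg_ r G (upd r c y).
  by rewrite (avg_upd c)// exchange_avg.
rewrite (upd1 (b, p')); apply: eq_avg => y4.
rewrite [LHS](upd1 (b, p)); apply: eq_avg => y3.
rewrite [LHS](upd1 (a, l')); apply: eq_avg => y2.
by rewrite [LHS](upd1 (a, l)); apply: eq_avg => y1.
Qed.

(** With the four vertices fixed, [base] arises from the random graph of [quad_prob] by deleting the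
    remaining pairs of drawn vertices. This is again a resampling, so the average exceeds
    [quad_prob] by at most [eps]. *)
Lemma avg_edge_box_le (a b : 'I_k) l l' p p' y1 y2 y3 y4 :
  (a < b)%N -> l != l' -> p != p' -> y1 != y2 -> y3 != y4 ->
  [set vtx a y1; vtx a y2; vtx b y3; vtx b y4] \in UU ->
  \avg_ r \avg_ x edge_box a b (upd4 a b l l' p p' y1 y2 y3 y4 r, x) l l' p p' <=
  mu R A ^+ 4 + theta + eps.
Proof.
move=> ab ll' pp' y12 y34 UUU.
have nab : (a == b) = false by apply/negbTE; rewrite -val_eqE neq_ltn ab.
have := quad_prob_le ab y12 y34 UUU; rewrite quad_prob_avg.
set U := [set _; _; _; vtx b y4]; set D := edges n :\: pairs U; set f := fun x => _.
set w := upd4 a b l l' p p' y1 y2 y3 y4 => fle.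
have w1 r : w r (a, l) = y1.
  by rewrite !ffunE !xpair_eqE nab (negPf ll') !eqxx.
have w2 r : w r (a, l') = y2.
  by rewrite !ffunE !xpair_eqE nab !eqxx.
have w3 r : w r (b, p) = y3.
  by rewrite !ffunE !xpair_eqE (negPf pp') !eqxx.
have w4 r : w r (b, p') = y4.
  by rewrite !ffunE !xpair_eqE !eqxx.
have wE r c : pick_vtx (w r) c \notin U -> w r c = r c.
  move=> cU; rewrite !ffunE.
  case: eqP => [cE|_]; first by rewrite cE /pick_vtx w4 !inE eqxx !orbT in cU.
  case: eqP => [cE|_]; first by rewrite cE /pick_vtx w3 !inE eqxx !orbT in cU.
  case: eqP => [cE|_]; first by rewrite cE /pick_vtx w2 !inE eqxx !orbT in cU.
  by case: eqP => [cE|//]; rewrite cE /pick_vtx w1 !inE eqxx in cU.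
clearbody w.
have UM r : U \subset picked (w r).
  apply/subsetP => t; rewrite !inE -!orbA => /or4P[] /eqP ->.
  - by have := pick_vtx_picked (w r) (a, l); rewrite /pick_vtx w1.
  - by have := pick_vtx_picked (w r) (a, l'); rewrite /pick_vtx w2.
  - by have := pick_vtx_picked (w r) (b, p); rewrite /pick_vtx w3.
  - by have := pick_vtx_picked (w r) (b, p'); rewrite /pick_vtx w4.
pose S r := pairs (picked (w r)) :\: pairs U.
have -> : \avg_ r \avg_ x edge_box a b (w r, x) l l' p p' =
    \avg_ r \avg_ x f ((x :\: S r) :|: set0).
  apply: eq_avg => r; apply: eq_avg => x.
  rewrite /edge_box /edge_ind /= /pick_vtx w1 w2 w3 w4 /f setU0.
  have -> : (x :\: S r) :&: D = base (w r) x.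
    apply/setP => e; rewrite !inE.
    have : (e \subset U) ==> (e \subset picked (w r)).
      by apply/implyP => eU; exact: subset_trans eU (UM r).
    by case: (e \in x); case: (#|e| == 2%N); case: (e \subset U); case: (e \subset _).
  by rewrite -!natrM !mulnb; congr ((nat_of_bool _)%:R); do 4 case: (_ \in A).
have /andP[_ h] : avg f - eps <= \avg_ r \avg_ x f ((x :\: S r) :|: set0) <= avg f + eps.
  apply: resample_picked.
  - by move=> r; exact: sub0set.
  - move=> r; apply: leq_trans (card_pairs_picked (w r)).
    by apply: subset_leq_card; exact: subsetDl.
  (* A common pair has a vertex outside [U]. It comes from coordinates that were not overwritten, so
     [r] and [r'] themselves agree there. *)
  - move=> r r' /set0Pn[e]; rewrite !inE.
    case/andP=> /andP[eU /andP[/subsetP ew e2]] /andP[_ /andP[/subsetP ew' _]].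
    move: eU; rewrite e2 andbT => /subsetPn[t te tU].
    have /imsetP[c _ tc] := ew _ te; have /imsetP[c' _ tc'] := ew' _ te.
    exists c, c'; rewrite -(wE r c); last by rewrite -tc.
    rewrite -(wE r' c'); last by rewrite -tc'.
    by have [] := vtx_inj (etrans (esym tc) tc').
  - by move=> x; rewrite ler0n lern1 leq_b1.
by apply: le_trans h _; rewrite lerD2r.
Qed.

Hypothesis UU4 : forall U, U \in UU -> #|U| = 4.
Hypothesis UUcard : (1 - theta) * ('C(n, 4))%:R <= #|UU|%:R.
Hypothesis theta0 : 0 <= theta.
Hypothesis nN : (n <= 2 * k * N)%N.

Lemma avg_vtx_in a (V : {set 'I_n}) : \avg_ y (vtx a y \in V)%:R <= #|V|%:R / N%:R :> R.
Proof.
rewrite /avg card_ord ler_wpM2r ?invr_ge0//.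
rewrite -natr_sum ler_nat -big_mkcond sum1_card.
have vinj : injective (vtx a) by move=> y y' /vtx_inj[].
rewrite -(card_imset _ vinj); apply/subset_leq_card/subsetP => t.
by case/imsetP => y yV ->.
Qed.

(** At most [theta * n^4] four-element sets lie outside [UU]. Each contains all four independent
    draws with probability at most [(4 / N)^4], and [4 n / N <= 8 k] by [nN]. *)
Lemma avg_not_UU (a b : 'I_k) : (a < b)%N ->
  \avg_ y4 \avg_ y3 \avg_ y2 \avg_ y1
    [&& y1 != y2, y3 != y4 &
      [set vtx a y1; vtx a y2; vtx b y3; vtx b y4] \notin UU]%:R <=
  theta * (8 * k)%:R ^+ 4 :> R.
Proof.
move=> ab.
pose B := [set V : {set 'I_n} | #|V| == 4] :\: UU.
have cardB : #|B|%:R <= theta * n%:R ^+ 4.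
  have UUsub : UU \subset [set V : {set 'I_n} | #|V| == 4].
    by apply/subsetP => U /UU4 U4; rewrite inE U4.
  rewrite cardsD (setIidPr UUsub) natrB ?subset_leq_card// card_draws card_ord.
  have : theta * ('C(n, 4))%:R <= theta * n%:R ^+ 4.
    rewrite ler_wpM2l// -natrX ler_nat.
    apply: (@leq_trans ('C(n, 4) * 4`!)); first by rewrite leq_pmulr ?fact_gt0.
    rewrite bin_ffact; do ! rewrite ffactnS; rewrite ffactn0 muln1 !expnS expn0 muln1.
    by rewrite !leq_mul// -?subn1 ?leq_subr// -!subnDA leq_subr.
  by move: UUcard; lra.
pose h c y (V : {set 'I_n}) : R := (vtx c y \in V)%:R.
(* When the event occurs, the four vertices are distinct and form a member of [B], whose summand is
   1. *)
apply: (@le_trans _ _ (\avg_ y4 \avg_ y3 \avg_ y2 \avg_ y1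
    \sum_(V in B) (h a y1 V * h a y2 V * h b y3 V * h b y4 V))).
  apply: avg_le => y4; apply: avg_le => y3; apply: avg_le => y2; apply: avg_le => y1.
  have h0 (V : {set 'I_n}) : 0 <= h a y1 V * h a y2 V * h b y3 V * h b y4 V.
    by rewrite !mulr_ge0.
  case: and3P => [[y12 y34 UUU]|_] /=; last by rewrite sumr_ge0.
  set U := [set _; _; _; _] in UUU *.
  have UB : U \in B.
    rewrite !inE UUU /=.
    have vneq c y y' : y != y' -> vtx c y != vtx c y'.
      by apply: contra => /eqP/vtx_inj[_ ->].
    have nab y y' : vtx a y != vtx b y'.
      by apply/eqP => /vtx_inj[ba _]; rewrite ba ltnn in ab.
    rewrite /U !cardsU !cards1 setIUl !setIUl.
    have s0 (u v : 'I_n) : u != v -> [set u] :&: [set v] = set0.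
      move=> uv; apply/setP => t; rewrite !inE.
      by case: eqP => // ->; rewrite (negPf uv).
    by rewrite !s0 ?vneq// !setU0 !cards0.
  rewrite (bigD1 U)//=.
  have -> : h a y1 U * h a y2 U * h b y3 U * h b y4 U = 1.
    by rewrite /h /U !inE !eqxx !orbT !mulr1.
  by rewrite lerDl sumr_ge0.
pose H c V := \avg_ y h c y V.
have -> : \avg_ y4 \avg_ y3 \avg_ y2 \avg_ y1
    \sum_(V in B) (h a y1 V * h a y2 V * h b y3 V * h b y4 V) =
    \sum_(V in B) H a V * H a V * H b V * H b V.
  transitivity (\avg_ y4 \avg_ y3 \avg_ y2
      \sum_(V in B) (H a V * h a y2 V * h b y3 V * h b y4 V)).
    do 3 (apply: eq_avg => ?); rewrite avg_sum; apply: eq_bigr => V _.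
    by rewrite !avgZr.
  transitivity (\avg_ y4 \avg_ y3 \sum_(V in B) (H a V * H a V * h b y3 V * h b y4 V)).
    do 2 (apply: eq_avg => ?); rewrite avg_sum; apply: eq_bigr => V _.
    by rewrite !avgZr avgZ.
  transitivity (\avg_ y4 \sum_(V in B) (H a V * H a V * H b V * h b y4 V)).
    apply: eq_avg => ?; rewrite avg_sum; apply: eq_bigr => V _.
    by rewrite avgZr avgZ.
  by rewrite avg_sum; apply: eq_bigr => V _; rewrite avgZ.
have N0' : 0 < N%:R :> R by rewrite ltr0n.
apply: (@le_trans _ _ (\sum_(V in B) (4 / N%:R) ^+ 4)).
  apply: ler_sum => V; rewrite !inE => /andP[_ /eqP V4].
  have H0 c : 0 <= H c V by apply: avg_ge0 => y; rewrite ler0n.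
  have H1 c : H c V <= 4 / N%:R by have := avg_vtx_in c V; rewrite V4.
  rewrite !exprSr expr0 mul1r.
  move: (H0 a) (H0 b) (H1 a) (H1 b); move: (H a V) (H b V) => u v u0 v0 u4 v4.
  by rewrite !ler_pM ?mulr_ge0.
rewrite sumr_const -[_ *+ _]mulr_natl.
apply: (@le_trans _ _ (theta * n%:R ^+ 4 * (4 / N%:R) ^+ 4)).
  by rewrite ler_wpM2r// exprn_ge0// divr_ge0 ?ler0n.
rewrite -mulrA -exprMn ler_wpM2l// lerXn2r ?nnegrE ?mulr_ge0 ?divr_ge0 ?invr_ge0 ?ler0n//.
rewrite mulrA ler_pdivrMr// -!natrM ler_nat.
by rewrite mulnC (_ : 8 * k * N = 4 * (2 * k * N))%N ?leq_mul2l// !mulnA.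
Qed.

Lemma mu_ge0 : 0 <= mu R A.
Proof. by rewrite mu_avg; apply: avg_ge0. Qed.

Lemma mu_le1 : mu R A <= 1.
Proof. by rewrite mu_avg; apply: le_avg1 => x; rewrite lern1 leq_b1. Qed.

(** Repeated indices cost [2 / L]. For distinct indices, the four draws are independent: repeated
    values cost [2 / N], quadruples outside [UU] cost the term with [(8 * k)^4], and quasirandomness
    governs the rest. *)
Lemma box_edge_ind (a b : 'I_k) : (a < b)%N ->
  \avg_ o box (edge_ind a b o) <=
  mu R A ^+ 4 + theta + eps + 2 / N%:R + theta * (8 * k)%:R ^+ 4 + 2 / L%:R.
Proof.
move=> ab.
set c := mu R A ^+ 4 + theta + eps + 2 / N%:R + theta * (8 * k)%:R ^+ 4.
have c0 : 0 <= c.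
  by rewrite /c !addr_ge0 ?exprn_ge0 ?mu_ge0 ?divr_ge0 ?ler0n// mulr_ge0 ?exprn_ge0.
have -> : \avg_ o box (edge_ind a b o) =
    \avg_ l \avg_ l' \avg_ p \avg_ p' \avg_ o edge_box a b o l l' p p'.
  transitivity (\avg_ o \avg_ l \avg_ l' \avg_ p \avg_ p' edge_box a b o l l' p p').
    by apply: eq_avg => o; exact: boxE.
  rewrite exchange_avg; apply: eq_avg => l.
  rewrite exchange_avg; apply: eq_avg => l'.
  rewrite exchange_avg; apply: eq_avg => p.
  by rewrite exchange_avg.
have O0 : (0 < #|{: choice_fun * {set {set 'I_n}}}|)%N by rewrite card_prod muln_gt0 W0 G0.
have := @avg4_le_diag R _ (fun l l' p p' => \avg_ o edge_box a b o l l' p p')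
  (fun _ _ _ _ => 0) c J0; rewrite card_ord.
rewrite !avg_cst// addr0; apply => l l' p p'; rewrite addr0.
have le1 : \avg_ o edge_box a b o l l' p p' <= 1.
  by apply: le_avg1 => o; exact: edge_box_le1.
have [ll'|ll'] := eqVneq l' l.
  by apply: le_trans le1 _; rewrite addrAC -[leLHS]add0r lerD// addr_ge0 ?ler0n.
have [pp'|pp'] := eqVneq p' p.
  by apply: le_trans le1 _; rewrite -[leLHS]add0r lerD// addr_ge0 ?ler0n.
rewrite !addr0.
have -> : \avg_ o edge_box a b o l l' p p' =
    \avg_ w \avg_ x edge_box a b (w, x) l l' p p'.
  by rewrite -avg_pair; apply: eq_avg => -[].
rewrite (avg_upd4 a b l l' p p').
rewrite /c; apply: le_trans _ (lerD (lexx _) (avg_not_UU ab)).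
have -> : 2 / N%:R = 2 / #|'I_N|%:R :> R by rewrite card_ord.
apply: avg4_le_diag => // y4 y3 y2 y1.
set G := \avg_ r _.
have G1 : G <= 1.
  by apply: le_avg1 => r; apply: le_avg1 => x; exact: edge_box_le1.
have c0' : 0 <= mu R A ^+ 4 + theta + eps.
  by rewrite !addr_ge0 ?exprn_ge0 ?mu_ge0.
have [y34|y34] := eqVneq y3 y4.
  have h (x y z : R) : 0 <= x -> 0 <= y -> 0 <= z -> G <= x + 1 + y + z by lra.
  by apply: h.
have [y12|y12] := eqVneq y1 y2.
  have h (x y z : R) : 0 <= x -> 0 <= y -> 0 <= z -> G <= x + y + 1 + z by lra.
  by apply: h.
rewrite /= !addr0.
case: (boolP (_ \in UU)) => [UUU|_] /=.
  by rewrite addr0; apply: avg_edge_box_le; rewrite // eq_sym.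
by apply: le_trans G1 _; rewrite lerDr.
Qed.

Lemma avg_base_ge :
  mu R A - eps <= \avg_(o : choice_fun * {set {set 'I_n}}) (base o.1 o.2 \in A)%:R.
Proof.
rewrite (avg_pair (fun w x => (base w x \in A)%:R)).
have /andP[h _] := avg_base (fun w => sub0set (pairs (picked w))).
apply: le_trans h _; rewrite le_eqVlt; apply/orP; left; apply/eqP.
by apply: eq_avg => w; apply: eq_avg => x; rewrite setU0.
Qed.

Lemma avg_edge_ind_ge (a b : 'I_k) : (a < b)%N ->
  mu R A - eps <= \avg_ o \avg_ l \avg_ p edge_ind a b o l p.
Proof.
move=> ab.
have -> : \avg_ o \avg_ l \avg_ p edge_ind a b o l p =
    \avg_ l \avg_ p \avg_ o edge_ind a b o l p.
  by rewrite exchange_avg; apply: eq_avg => l; rewrite exchange_avg.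
rewrite -(avg_cst (_ - _) J0); apply: avg_le => l.
rewrite -(avg_cst (_ - _) J0); apply: avg_le => p.
rewrite (avg_pair (fun w x => edge_ind a b (w, x) l p)).
(* Vertices from different blocks are distinct, so the added set has two elements. *)
have sub w : [set [set pick_vtx w (a, l); pick_vtx w (b, p)]] \subset pairs (picked w).
  rewrite sub1set inE subUset !sub1set !pick_vtx_picked cards2 /=.
  by rewrite eqSS eqb1; apply/eqP => /vtx_inj[/= ba _]; rewrite ba ltnn in ab.
by have /andP[] := avg_base sub.
Qed.

(** Through [box_deviation] the mean and box estimates give the box bound [kappa ^+ 4], so
    [counting] loses at most [kappa] per pair of blocks and [large] keeps its lower bound positive.
    Any outcome with positive product then gives [K] and [W]. *)
Lemma exists_clique (es := increasing_pairs k) (eta kappa : R) :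
  theta + eps + 2 / N%:R + theta * (8 * k)%:R ^+ 4 + 2 / L%:R <= eta ->
  0 <= kappa -> 30 * eta <= kappa ^+ 4 ->
  (size es)%:R * kappa < mu R A ^+ size es * (mu R A - eta) ->
  exists K : {set 'I_n}, #|K| = k /\
  exists W : {set {set 'I_n}}, W \subset edges n :\: pairs K /\
    W \in A /\ (forall e, e \in pairs K -> W :|: [set e] \in A).
Proof.
move=> etaP kappa0 eta_kappa large.
have mu01 : 0 <= mu R A <= 1 by rewrite mu_ge0 mu_le1.
have O0 : (0 < #|{: choice_fun * {set {set 'I_n}}}|)%N by rewrite card_prod muln_gt0 W0 G0.
have eps_eta : eps <= eta.
  apply: le_trans etaP.
  have h (x y z : R) : 0 <= x -> 0 <= y -> 0 <= z -> eps <= theta + eps + x + y + z.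
    by move: theta0; lra.
  by apply: h; rewrite ?divr_ge0 ?mulr_ge0 ?exprn_ge0.
have eta0 : 0 <= eta by exact: le_trans eps_eta.
have dev (a b : 'I_k) : (a < b)%N ->
    \avg_ o box (fun l p => edge_ind a b o l p - mu R A) <= kappa ^+ 4.
  move=> ab; apply: le_trans eta_kappa; apply: box_deviation => //.
    by apply: le_trans (avg_edge_ind_ge ab); rewrite lerB.
  by apply: le_trans (box_edge_ind ab) _; rewrite -!addrA lerD2l !addrA.
have es_lt : all (fun q : 'I_k * 'I_k => (q.1 < q.2)%N) es by exact: filter_all.
have es_uniq : uniq es by rewrite filter_uniq// enum_uniq.
have base01 (o : choice_fun * {set {set 'I_n}}) :
    0 <= ((base o.1 o.2 \in A)%:R : R) <= 1 by rewrite ler0n lern1 leq_b1.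
have := counting (X0 := fun o => (base o.1 o.2 \in A)%:R) O0 L0 mu01 kappa0
  base01 edge_ind01 dev es_uniq es_lt.
set total := (X in _ <= X) => count.
have total0 : 0 < total.
  apply: lt_le_trans _ count; rewrite subr_gt0; apply: lt_le_trans large _.
  rewrite ler_wpM2l ?exprn_ge0 ?mu_ge0//.
  by apply: le_trans avg_base_ge; rewrite lerB.
have [o [z oz]] : exists o : choice_fun * {set {set 'I_n}},
    exists z : {ffun 'I_k -> 'I_L},
    0 < (base o.1 o.2 \in A)%:R *
      \prod_(q <- es) edge_ind q.1 q.2 o (z q.1) (z q.2).
  have [/existsP[o /existsP[z oz]]|] := boolP [exists o : choice_fun * {set {set 'I_n}},
      exists z : {ffun 'I_k -> 'I_L},
      0 < (base o.1 o.2 \in A)%:R *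
        \prod_(q <- es) edge_ind q.1 q.2 o (z q.1) (z q.2)]; first by exists o, z.
  move=> /existsPn none; move: total0; rewrite ltNge => /negP[].
  have Z0 : (0 < #|{ffun 'I_k -> 'I_L}|)%N by rewrite card_ffun expn_gt0 J0.
  rewrite -(avg_cst 0 O0); apply: avg_le => o.
  rewrite -(avg_cst 0 Z0); apply: avg_le => z.
  by have /existsPn/(_ z) := none o; rewrite -leNgt.
pose c a := pick_vtx o.1 (a, z a).
have c_inj : injective c by move=> a a' /vtx_inj[].
have baseA : base o.1 o.2 \in A.
  by move: oz; case: (_ \in A); rewrite ?mul0r ?ltxx.
have edgeA (a b : 'I_k) : (a < b)%N -> base o.1 o.2 :|: [set [set c a; c b]] \in A.
  move=> ab; apply: contraTT oz => notA.
  have abes : (a, b) \in es by rewrite mem_filter ab mem_enum inE.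
  rewrite -leNgt (big_rem _ abes) /= {1}/edge_ind.
  by rewrite (negPf notA) mul0r mulr0.
exists [set c a | a : 'I_k]; split; first by rewrite card_imset// card_ord.
(* [base] avoids every pair of drawn vertices, in particular the pairs of the [k] selected ones. *)
exists (base o.1 o.2); split; last split => //.
  apply: setDSS; first exact: subsetIr.
  apply/subsetP => e; rewrite !inE => /andP[eK ->]; rewrite andbT.
  apply: subset_trans eK _; apply/subsetP => t /imsetP[a _ ->].
  exact: pick_vtx_picked.
move=> e; rewrite inE => /andP[/subsetP eK /cards2P[u [v [uv ee]]]].
have /imsetP[a _ ua] : u \in [set c a | a : 'I_k] by apply: eK; rewrite ee !inE eqxx.
have /imsetP[b _ vb] : v \in [set c a | a : 'I_k] by apply: eK; rewrite ee !inE eqxx orbT.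
have : a != b by apply: contra uv => /eqP ab; rewrite ua vb ab.
rewrite ee ua vb -val_eqE neq_ltn => /orP[ab|ba]; first exact: edgeA.
by rewrite [[set c a; c b]]setUC; exact: edgeA.
Qed.

End RandomBlocks.

(** * Consecutive blocks and the choice of constants *)

Lemma exists_nat_gt (R : realType) (x : R) : exists M : nat, x < M%:R.
Proof.
exists (Num.bound `|x|).
by apply: le_lt_trans (ler_norm x) _; exact: archi_boundP.
Qed.

Lemma block_lt n k N (a : 'I_k) (y : 'I_N) : (k * N <= n)%N -> (a * N + y < n)%N.
Proof.
move=> kN; apply: leq_trans kN.
by apply: (@leq_trans (a.+1 * N)); rewrite ?leq_mul2r ?ltn_ord ?orbT// mulSn addnC ltn_add2r.
Qed.

Definition block_vtx n k N (kN : (k * N <= n)%N) (a : 'I_k) (y : 'I_N) : 'I_n :=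
  Ordinal (block_lt a y kN).

Lemma block_vtx_lt n k N (kN : (k * N <= n)%N) (a b : 'I_k) y y' :
  (a < b)%N -> (block_vtx kN a y < block_vtx kN b y')%N.
Proof.
move=> ab /=; apply: (@leq_trans (a.+1 * N)); first by rewrite mulSn addnC ltn_add2r.
by apply: leq_trans (leq_addr _ _); rewrite leq_mul2r ab orbT.
Qed.

Lemma block_vtx_inj n k N (kN : (k * N <= n)%N) (a b : 'I_k) y y' :
  block_vtx kN a y = block_vtx kN b y' -> a = b /\ y = y'.
Proof.
move=> /(congr1 val) /= eqv.
have ab : a = b.
  apply: val_inj; case: (ltngtP a b) => // lt.
    by have := block_vtx_lt kN y y' lt; rewrite /= eqv ltnn.
  by have := block_vtx_lt kN y' y lt; rewrite /= eqv ltnn.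
by move: eqv; rewrite ab /= => /addnI/val_inj.
Qed.

Theorem theorem1p8 (R : realType) (delta : R) (k : nat) :
  0 < delta -> delta <= 1 -> (2 <= k)%N ->
  exists theta : R, 0 < theta /\
  exists q0 : nat, (k <= q0)%N /\
  forall (n : nat) (A : {set {set {set 'I_n}}}),
    (q0 <= n)%N -> is_family A -> quasirandom theta A -> delta <= mu R A ->
    exists K : {set 'I_n}, #|K| = k /\
    exists W : {set {set 'I_n}}, W \subset edges n :\: pairs K /\
      W \in A /\ (forall e, e \in pairs K -> W :|: [set e] \in A).
Proof.
move=> delta0 delta1 k2; have k0 : (0 < k)%N by exact: ltnW.
set t := size (increasing_pairs k).
have dt0 : 0 < delta ^+ t.+1 by rewrite exprn_gt0.
have dt1 : delta ^+ t.+1 <= 1 by rewrite exprn_ile1// ltW.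
have t1 : 1 <= (t.+1)%:R :> R by rewrite ler1n.
(* The [t] replacements then lose at most [delta ^+ t.+1 / 4] in total, and [eta <= kappa] loses at
   most as much again, against a main term of at least [delta ^+ t.+1]. *)
pose kappa : R := delta ^+ t.+1 / (4 * (t.+1)%:R).
have t0 : 0 < 4 * (t.+1)%:R :> R by rewrite mulr_gt0.
have kappaE : (t.+1)%:R * kappa = delta ^+ t.+1 / 4.
  by rewrite /kappa; field; rewrite -natr1 in t1 *; lra.
have kappa0 : 0 < kappa by rewrite divr_gt0.
have kappa_le : kappa <= delta ^+ t.+1 / 4 by rewrite -kappaE ler_peMl// ltW.
pose eta : R := kappa ^+ 4 / 30.
have eta0 : 0 < eta by rewrite divr_gt0// exprn_gt0.
have eta_kappa : eta <= kappa.
  have : kappa ^+ 4 <= kappa.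
    rewrite exprS ler_piMr ?exprn_ile1 ?ltW//; lra.
  by rewrite /eta; lra.
(* The errors sum to at most [4 * eps]: one [eps] each for resampling, [2 / N], [2 / L] and the two
   [theta] terms together. *)
pose eps := eta / 5.
have eps0 : 0 < eps by rewrite divr_gt0.
have [L hL] := exists_nat_gt (2 / eps).
have L0 : (0 < L)%N.
  by rewrite -(ltr0n R); apply: lt_trans hL; rewrite divr_gt0.
pose c : R := (8 * k)%:R ^+ 4.
have c0 : 0 <= c by rewrite exprn_ge0.
pose theta := eps / (1 + c).
have theta0 : 0 < theta by rewrite divr_gt0// ltr_pwDl.
have thetaE : theta + theta * c = eps.
  by rewrite /theta; field; lra.
exists theta; split=> //.
pose C : R := 2 ^+ (2 ^ (k * L)) * ((k * L) ^ 2)%:R.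
have C0 : 0 <= C by rewrite mulr_ge0// exprn_ge0.
(* The two summands ensure [2 / N <= eps] and [C / N <= eps ^+ 2] for every block size [N >= M]. *)
have [M hM] := exists_nat_gt (2 / eps + C / eps ^+ 2).
have eps2 : 0 < 2 / eps by rewrite divr_gt0.
have Ceps : 0 <= C / eps ^+ 2 by rewrite divr_ge0// exprn_ge0// ltW.
have M0 : (0 < M)%N by rewrite -(ltr0n R); lra.
exists (k * M)%N; split; first by rewrite leq_pmulr.
move=> n A nM famA [UU [UU4 [UUcard quadP]]] muA.
pose N := (n %/ k)%N.
have MN : (M <= N)%N by rewrite leq_divRL// mulnC.
have N0 : (0 < N)%N by exact: leq_trans MN.
have kN : (k * N <= n)%N by rewrite mulnC leq_divM.
(* The remainder of [n] modulo [k] is below [k], hence at most [k * N] because [N] is positive. *)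
have nN : (n <= 2 * k * N)%N.
  rewrite {1}(divn_eq n k) -/N mulnAC -mulnA mul2n -addnn mulnC leq_add2l.
  by apply: leq_trans (ltnW (ltn_pmod n k0)) _; rewrite leq_pmulr.
have NR0 : 0 < N%:R :> R by rewrite ltr0n.
have NR : 2 / eps + C / eps ^+ 2 < N%:R by apply: lt_le_trans hM _; rewrite ler_nat.
have N2 : 2 / N%:R <= eps.
  rewrite ler_pdivrMr// mulrC -ler_pdivrMr//; lra.
have NC : 2 ^+ (2 ^ (k * L)) * (((k * L) ^ 2)%:R / N%:R) <= eps ^+ 2.
  rewrite mulrA -/C ler_pdivrMr// mulrC -ler_pdivrMr ?exprn_gt0//; lra.
have L2 : 2 / L%:R <= eps.
  by rewrite ler_pdivrMr ?ltr0n// mulrC -ler_pdivrMr// ltW.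
apply: (exists_clique (@block_vtx_inj n k N kN) (@block_vtx_lt n k N kN) L0 N0 famA
  (ltW eps0) NC quadP UU4 UUcard (ltW theta0) nN (eta := eta) (kappa := kappa)).
- have -> : eta = eps + eps + eps + eps + eps by rewrite /eps; field.
  rewrite -/c; lra.
- exact: ltW.
- by rewrite /eta; lra.
rewrite -/t.
have mu1 : mu R A <= 1 by exact: mu_le1.
have mu0 : 0 <= mu R A by exact: mu_ge0.
have : delta ^+ t.+1 <= mu R A ^+ t.+1 by rewrite lerXn2r ?nnegrE// ltW.
have : mu R A ^+ t * eta <= eta by rewrite ler_piMl ?exprn_ile1// ltW.
have : t%:R * kappa <= (t.+1)%:R * kappa by rewrite ler_wpM2r ?ler_nat// ltW.
rewrite kappaE [mu R A ^+ t.+1]exprSr mulrBr.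
by move: eta_kappa kappa_le dt0; lra.
Qed.
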